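(* Let $\mathbf{D}$ be a triangulated category with shift functor $\Sigma$. Then the assignment $$(\mathcal{E},\mathcal{M})\longmapsto \big(0/\mathcal{E},\ \Sigma(\mathcal{M}/0)\big)$$ is a well-defined bijection from the class of normal triangulated torsion theories on $\mathbf{D}$ to the class of $t$-structures on $\mathbf{D}$, where $0/\mathcal{E}=\{X\in\mathbf{D} : (0\to X)\in\mathcal{E}\}$ and $\mathcal{M}/0=\{X\in\mathbf{D} : (X\to 0)\in\mathcal{M}\}$ (viewed as full subcategories).
   Context: Homotopy orthogonality. For morphisms $e:E_0\to E_1$ and $m:M_0\to M_1$ of $\mathbf{D}$, choose distinguished triangles $E_0\xrightarrow{e}E_1\xrightarrow{\alpha_e}C_e\xrightarrow{\beta_e}\Sigma E_0$ and $M_0\xrightarrow{m}M_1\xrightarrow{\alpha_m}C_m\xrightarrow{\beta_m}\Sigma M_0$. Write $e\perp_h m$ if: (HO1) the map $\mathbf{D}(C_e,\Sigma^{-1}C_m)\to\mathbf{D}(E_1,M_0)$, $\varphi\mapsto \Sigma^{-1}(\beta_m)\circ\varphi\circ\alpha_e$, is zero; and (HO2) the map $\mathbf{D}(C_e,C_m)\to\mathbf{D}(E_1,\Sigma M_0)$, $\varphi\mapsto\beta_m\circ\varphi\circ\alpha_e$, is injective. (This does not depend on the chosen triangles.) For a class $\mathcal{X}$ of morphisms, $\mathcal{X}^{\perp_h}$ is the class of all $f$ with $x\perp_h f$ for all $x\in\mathcal{X}$, and ${}^{\perp_h}\mathcal{X}$ is the class of all $f$ with $f\perp_h x$ for all $x\in\mathcal{X}$.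 Triangulated factorization systems. A pair $(\mathcal{E},\mathcal{M})$ of classes of morphisms of $\mathbf{D}$ is a triangulated pre-factorization system if $\mathcal{E}^{\perp_h}=\mathcal{M}$, ${}^{\perp_h}\mathcal{M}=\mathcal{E}$, and $\phi\in\mathcal{E}$ implies $\Sigma\phi\in\mathcal{E}$. It is a triangulated factorization system if moreover every morphism $\phi$ of $\mathbf{D}$ factors as $\phi=m\circ e$ with $e\in\mathcal{E}$, $m\in\mathcal{M}$. A class of morphisms has the 3-for-2 property if for composable $f,g$, whenever two of $f,g,g\circ f$ are in the class, so is the third. A triangulated factorization system is a triangulated torsion theory if both $\mathcal{E}$ and $\mathcal{M}$ have the 3-for-2 property. A triangulated factorization system is normal if, for every factorization $X\xrightarrow{e}T\xrightarrow{m}0$ with $e\in\mathcal{E}$, $m\in\mathcal{M}$, and every distinguished triangle $R\to X\xrightarrow{e}T\to\Sigma R$, the map $R\to0$ belongs to $\mathcal{E}$. $t$-structures. A $t$-structure on $\mathbf{D}$ is a pair $(\mathbf{D}^{\le0},\mathbf{D}^{\ge0})$ of (isomorphism-closed) full subcategories such that, with $\mathbf{D}^{\le n}=\Sigma^{-n}\mathbf{D}^{\le0}$ and $\mathbf{D}^{\ge n}=\Sigma^{-n}\mathbf{D}^{\ge0}$: $\mathbf{D}(X,Y)=0$ for $X\in\mathbf{D}^{\le0}$, $Y\in\mathbf{D}^{\ge1}$; $\mathbf{D}^{\le-1}\subseteq\mathbf{D}^{\le0}$ and $\mathbf{D}^{\ge1}\subseteq\mathbf{D}^{\ge0}$; every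 $X$ fits into a distinguished triangle $X^{\le0}\to X\to X^{\ge1}\to\Sigma X^{\le0}$ with $X^{\le0}\in\mathbf{D}^{\le0}$, $X^{\ge1}\in\mathbf{D}^{\ge1}$. *)

(* Defs.v *)
From HB Require Import structures.
From mathcomp Require Import all_boot all_order all_algebra.
From mathcomp Require Import boolp classical_sets functions.

Set Implicit Arguments.
Unset Strict Implicit.
Unset Printing Implicit Defensive.

Import GRing.Theory.
Local Open Scope ring_scope.
Local Open Scope classical_set_scope.

Record preaddCategory := PreaddCategory {
  obj :> Type;
  Hom : obj -> obj -> zmodType;
  idm : forall X, Hom X X;
  compm : forall X Y Z, Hom Y Z -> Hom X Y -> Hom X Z;
  compmA : forall X Y Z W (h : Hom Z W) (g : Hom Y Z) (f : Hom X Y),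
    compm h (compm g f) = compm (compm h g) f;
  comp1m : forall X Y (f : Hom X Y), compm (idm Y) f = f;
  compm1 : forall X Y (f : Hom X Y), compm f (idm X) = f;
  compmDl : forall X Y Z (g g' : Hom Y Z) (f : Hom X Y),
    compm (g + g') f = compm g f + compm g' f;
  compmDr : forall X Y Z (g : Hom Y Z) (f f' : Hom X Y),
    compm g (f + f') = compm g f + compm g f'
}.

Arguments Hom {p} X Y.
Arguments idm {p} X.

Notation "g \oc f" := (compm g f) (at level 40, left associativity).

Definition is_iso (C : preaddCategory) (X Y : C) (f : Hom X Y) : Prop :=
  exists g : Hom Y X, g \oc f = idm X /\ f \oc g = idm Y.

Definition isomorphic (C : preaddCategory) (X Y : C) : Prop :=
  exists f : Hom X Y, is_iso f.

Definition iso_closed (C : preaddCategory) (S : set C) : Prop :=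
  forall X Y : C, isomorphic X Y -> S X -> S Y.

Record addCategory := AddCategory {
  addcat :> preaddCategory;
  zobj : addcat;
  zobj_initial : forall (X : addcat) (f : Hom zobj X), f = 0;
  zobj_terminal : forall (X : addcat) (f : Hom X zobj), f = 0;
  biproduct : forall X Y : addcat,
    exists (Z : addcat) (i1 : Hom X Z) (i2 : Hom Y Z)
           (p1 : Hom Z X) (p2 : Hom Z Y),
      [/\ p1 \oc i1 = idm X, p2 \oc i2 = idm Y,
          p2 \oc i1 = 0, p1 \oc i2 = 0 &
          i1 \oc p1 + i2 \oc p2 = idm Z]
}.

Arguments zobj {a}.

Record addFunctor (C D : preaddCategory) := AddFunctor {
  fob :> C -> D;
  fmor : forall X Y : C, Hom X Y -> Hom (fob X) (fob Y);
  fmor1 : forall X : C, fmor (idm X) = idm (fob X);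
  fmorM : forall (X Y Z : C) (g : Hom Y Z) (f : Hom X Y),
    fmor (g \oc f) = fmor g \oc fmor f;
  fmorD : forall (X Y : C) (f g : Hom X Y), fmor (f + g) = fmor f + fmor g
}.

(* The shift is an autoequivalence with a chosen quasi-inverse [desusp]; a
   strict automorphism is the case where [desuspK] and [suspK] are
   identities. *)
Record shiftCategory := ShiftCategory {
  shiftcat :> addCategory;
  susp : addFunctor shiftcat shiftcat;
  desusp : addFunctor shiftcat shiftcat;
  desuspK : forall X : shiftcat, Hom (desusp (susp X)) X;
  desuspK_iso : forall X : shiftcat, is_iso (desuspK X);
  desuspK_natural : forall (X Y : shiftcat) (f : Hom X Y),
    f \oc desuspK X = desuspK Y \oc fmor desusp (fmor susp f);
  suspK : forall X : shiftcat, Hom (susp (desusp X)) X;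
  suspK_iso : forall X : shiftcat, is_iso (suspK X);
  suspK_natural : forall (X Y : shiftcat) (f : Hom X Y),
    f \oc suspK X = suspK Y \oc fmor susp (fmor desusp f)
}.

Arguments susp {s}.
Arguments desusp {s}.
Arguments desuspK {s} X.
Arguments suspK {s} X.

(* The last field is Verdier's octahedral axiom. *)
Record triangulatedCategory := TriangulatedCategory {
  tricat :> shiftCategory;
  dist : forall X Y Z : tricat,
    Hom X Y -> Hom Y Z -> Hom Z (susp X) -> Prop;
  dist_iso : forall (X Y Z X' Y' Z' : tricat)
      (u : Hom X Y) (v : Hom Y Z) (w : Hom Z (susp X))
      (u' : Hom X' Y') (v' : Hom Y' Z') (w' : Hom Z' (susp X'))
      (f : Hom X X') (g : Hom Y Y') (h : Hom Z Z'),
    is_iso f -> is_iso g -> is_iso h ->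
    g \oc u = u' \oc f -> h \oc v = v' \oc g -> fmor susp f \oc w = w' \oc h ->
    dist u v w -> dist u' v' w';
  dist_id : forall X : tricat,
    dist (idm X) (0 : Hom X zobj) (0 : Hom zobj (susp X));
  dist_cone : forall (X Y : tricat) (u : Hom X Y),
    exists (Z : tricat) (v : Hom Y Z) (w : Hom Z (susp X)), dist u v w;
  dist_rot : forall (X Y Z : tricat)
      (u : Hom X Y) (v : Hom Y Z) (w : Hom Z (susp X)),
    dist u v w <-> dist v w (- fmor susp u);
  dist_mor : forall (X Y Z X' Y' Z' : tricat)
      (u : Hom X Y) (v : Hom Y Z) (w : Hom Z (susp X))
      (u' : Hom X' Y') (v' : Hom Y' Z') (w' : Hom Z' (susp X'))
      (f : Hom X X') (g : Hom Y Y'),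
    dist u v w -> dist u' v' w' -> g \oc u = u' \oc f ->
    exists h : Hom Z Z',
      h \oc v = v' \oc g /\ fmor susp f \oc w = w' \oc h;
  dist_octa : forall (X Y Z X' Y' Z' : tricat) (f : Hom X Y) (g : Hom Y Z)
      (i : Hom Y Z') (j : Hom Z' (susp X))
      (k : Hom Z X') (l : Hom X' (susp Y))
      (m : Hom Z Y') (n : Hom Y' (susp X)),
    dist f i j -> dist g k l -> dist (g \oc f) m n ->
    exists (u : Hom Z' Y') (v : Hom Y' X'),
      [/\ dist u v (fmor susp i \oc l),
          u \oc i = m \oc g, n \oc u = j,
          v \oc m = k & l \oc v = fmor susp f \oc n]
}.

Section Definitions.
Variable D : triangulatedCategory.

(* The map D(Ce, Sigma^-1 Cm) -> D(E1, M0); [desuspK M0] identifies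
   Sigma^-1 (Sigma M0) with M0. *)
Definition ho1_map (E1 Ce M0 Cm : D)
    (ae : Hom E1 Ce) (bm : Hom Cm (susp M0))
    (phi : Hom Ce (desusp Cm)) : Hom E1 M0 :=
  desuspK M0 \oc fmor desusp bm \oc phi \oc ae.

Definition ho2_map (E1 Ce M0 Cm : D)
    (ae : Hom E1 Ce) (bm : Hom Cm (susp M0))
    (phi : Hom Ce Cm) : Hom E1 (susp M0) :=
  bm \oc phi \oc ae.

(* Any two triangles completing a given morphism are isomorphic, so the
   conditions do not depend on the triangles; they are required for all of
   them, and [dist_cone] makes this non-vacuous. *)
Definition horth (E0 E1 M0 M1 : D) (e : Hom E0 E1) (m : Hom M0 M1) : Prop :=
  forall (Ce : D) (ae : Hom E1 Ce) (be : Hom Ce (susp E0))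
         (Cm : D) (am : Hom M1 Cm) (bm : Hom Cm (susp M0)),
    dist e ae be -> dist m am bm ->
    (forall phi, ho1_map ae bm phi = 0) /\ injective (ho2_map ae bm).

Definition morclass := forall X Y : D, set (Hom X Y).

Definition rorth (A : morclass) : morclass := fun X Y f =>
  forall (X' Y' : D) (x : Hom X' Y'), A X' Y' x -> horth x f.

Definition lorth (A : morclass) : morclass := fun X Y f =>
  forall (X' Y' : D) (x : Hom X' Y'), A X' Y' x -> horth f x.

Record pre_factorization_system (E M : morclass) : Prop := {
  pfs_rorth : rorth E = M;
  pfs_lorth : lorth M = E;
  pfs_susp : forall (X Y : D) (phi : Hom X Y),
    E X Y phi -> E (susp X) (susp Y) (fmor susp phi)
}.

Record factorization_system (E M : morclass) : Prop := {
  fs_pre : pre_factorization_system E M;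
  fs_factor : forall (X Y : D) (phi : Hom X Y),
    exists (T : D) (e : Hom X T) (m : Hom T Y),
      [/\ E X T e, M T Y m & phi = m \oc e]
}.

Definition three_for_two (A : morclass) : Prop :=
  forall (X Y Z : D) (f : Hom X Y) (g : Hom Y Z),
    [/\ A _ _ f -> A _ _ g -> A _ _ (g \oc f),
        A _ _ f -> A _ _ (g \oc f) -> A _ _ g &
        A _ _ g -> A _ _ (g \oc f) -> A _ _ f].

Record torsion_theory (E M : morclass) : Prop := {
  tt_fs : factorization_system E M;
  tt_E32 : three_for_two E;
  tt_M32 : three_for_two M
}.

Definition normal (E M : morclass) : Prop :=
  forall (X T : D) (e : Hom X T) (m : Hom T zobj), E _ _ e -> M _ _ m ->
  forall (R : D) (r : Hom R X) (w : Hom T (susp R)), dist r e w ->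
    E R zobj 0.

Definition normal_torsion_theory : set (morclass * morclass) :=
  [set EM | torsion_theory EM.1 EM.2 /\ normal EM.1 EM.2].

Definition suspz (n : int) (X : D) : D :=
  match n with
  | Posz k => iter k susp X
  | Negz k => iter k.+1 desusp X
  end.

(* The essential image: with a strictly invertible shift and an
   isomorphism-closed S, this is the usual Sigma^n S. *)
Definition susp_class (n : int) (S : set D) : set D :=
  [set X | exists2 Y, S Y & isomorphic X (suspz n Y)].

Definition le_part (Dle : set D) (n : int) : set D := susp_class (- n) Dle.
Definition ge_part (Dge : set D) (n : int) : set D := susp_class (- n) Dge.

Record is_t_structure (Dle Dge : set D) : Prop := {
  tle_iso : iso_closed Dle;
  tge_iso : iso_closed Dge;
  t_orth : forall X Y : D, Dle X -> ge_part Dge 1 Y ->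
    forall f : Hom X Y, f = 0;
  tle_sub : le_part Dle (-1) `<=` Dle;
  tge_sub : ge_part Dge 1 `<=` Dge;
  t_trunc : forall X : D,
    exists (A B : D) (u : Hom A X) (v : Hom X B) (w : Hom B (susp A)),
      [/\ Dle A, ge_part Dge 1 B & dist u v w]
}.

Definition t_structure : set (set D * set D) :=
  [set t | is_t_structure t.1 t.2].

Definition coslice0 (E : morclass) : set D := [set X | E zobj X 0].
Definition slice0 (M : morclass) : set D := [set X | M X zobj 0].

Definition t_of_tt (EM : morclass * morclass) : set D * set D :=
  (coslice0 EM.1, susp_class 1 (slice0 EM.2)).

End Definitions.

(* Main.v *)
From mathcomp Require Import all_boot all_order all_algebra boolp.
Require Import Defs.
From mathcomp Require Import classical_sets functions.

(** A normal triangulated torsion theory (E, M) is determined by the two classes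
    of objects U = 0/E and V = M/0, and the pairs (U, V) that arise in this way
    are exactly the pairs (aisle, coaisle) of t-structures.

    The passage from morphisms to objects rests on homotopy orthogonality
    against a map to or from 0: [e] is orthogonal to [W -> 0] exactly when
    Hom(e, W) is bijective ([horth_to_zero]), and [0 -> A] is orthogonal to [m]
    exactly when Hom(A, m) is bijective ([horth_from_zero]).  So in a torsion
    theory the maps of E are inverted by Hom(-, W) for all W in V, and the maps
    of M by Hom(A, -) for all A in U.

    Conversely, given a t-structure with aisle U and coaisle V, let E consist of
    the maps inverted by Hom(-, W) for all W in V, and M of the maps inverted by
    Hom(A, -) for all A in U.  Informally, these are the maps whose coaisle,
    respectively aisle, truncation is an isomorphism.  The 3-for-2 properties
    are then immediate, and [X -> Y] is factored through a homotopy pushout built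
    from the truncation triangles of [X] and [Y] ([t_pair_factor]).  What remains
    is that E and M are homotopy orthogonal ([inverted_horth_coinverted]).  Its
    core is [reflection_susp_mono]: a map [X -> T] of E with T in V is, up to
    isomorphism, the coaisle truncation of [X], so that it detects maps from [T]
    to suspensions of objects of V, and not only to objects of V.  The same
    lemma gives normality.

    In the other direction, normality is what turns a factorization of [X -> 0]
    into a truncation triangle of [X] ([normal_torsion_theory_t_pair]).  The
    assignment is injective because (E, M) is recovered from (U, V): both classes
    are included in those built from (U, V), and taking orthogonals reverses the
    inclusion ([normal_torsion_theory_inverted]). *)

Set Implicit Arguments.
Unset Strict Implicit.
Unset Printing Implicit Defensive.

Import GRing.Theory.
Local Open Scope ring_scope.
Local Open Scope classical_set_scope.

(** * Additive categories *)

Section Additive.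
Variable C : preaddCategory.

Lemma compm0 (X Y Z : C) (g : Hom Y Z) : g \oc (0 : Hom X Y) = 0.
Proof. by apply: (addrI (g \oc 0)); rewrite -compmDr !addr0. Qed.

Lemma comp0m (X Y Z : C) (f : Hom X Y) : (0 : Hom Y Z) \oc f = 0.
Proof. by apply: (addrI (0 \oc f)); rewrite -compmDl !addr0. Qed.

Lemma compmN (X Y Z : C) (g : Hom Y Z) (f : Hom X Y) : g \oc (- f) = - (g \oc f).
Proof. by apply: (addrI (g \oc f)); rewrite -compmDr !subrr compm0. Qed.

Lemma compNm (X Y Z : C) (g : Hom Y Z) (f : Hom X Y) : (- g) \oc f = - (g \oc f).
Proof. by apply: (addrI (g \oc f)); rewrite -compmDl !subrr comp0m. Qed.

Lemma compmB (X Y Z : C) (g : Hom Y Z) (f f' : Hom X Y) :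
  g \oc (f - f') = g \oc f - g \oc f'.
Proof. by rewrite compmDr compmN. Qed.

Lemma compBm (X Y Z : C) (g g' : Hom Y Z) (f : Hom X Y) :
  (g - g') \oc f = g \oc f - g' \oc f.
Proof. by rewrite compmDl compNm. Qed.

Lemma is_iso_idm (X : C) : is_iso (idm X).
Proof. by exists (idm X); rewrite comp1m. Qed.

Lemma isomorphic_refl (X : C) : isomorphic X X.
Proof. by exists (idm X); apply: is_iso_idm. Qed.

Lemma isomorphic_sym (X Y : C) : isomorphic X Y -> isomorphic Y X.
Proof. by move=> [f [g [gf fg]]]; exists g, f. Qed.

Lemma isomorphic_trans (Y X Z : C) :
  isomorphic X Y -> isomorphic Y Z -> isomorphic X Z.
Proof.
move=> [f [f' [f'f ff']]] [g [g' [g'g gg']]]; exists (g \oc f), (f' \oc g').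
split.
  by rewrite -compmA [g' \oc (g \oc f)]compmA g'g comp1m.
by rewrite -compmA [f \oc (f' \oc g')]compmA ff' comp1m.
Qed.

Lemma fmor0 (C' : preaddCategory) (F : addFunctor C C') (X Y : C) :
  fmor F (0 : Hom X Y) = 0.
Proof. by apply: (addrI (fmor F 0)); rewrite -fmorD !addr0. Qed.

Lemma fmorB (C' : preaddCategory) (F : addFunctor C C') (X Y : C)
    (f g : Hom X Y) :
  fmor F (f - g) = fmor F f - fmor F g.
Proof. by apply: (addIr (fmor F g)); rewrite -fmorD !subrK. Qed.

Lemma fmorN (C' : preaddCategory) (F : addFunctor C C') (X Y : C) (f : Hom X Y) :
  fmor F (- f) = - fmor F f.
Proof. by rewrite -sub0r fmorB fmor0 sub0r. Qed.

Lemma isomorphic_fob (C' : preaddCategory) (F : addFunctor C C') (X Y : C) :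
  isomorphic X Y -> isomorphic (F X) (F Y).
Proof.
move=> [f [g [gf fg]]]; exists (fmor F f), (fmor F g).
by rewrite -!fmorM gf fg !fmor1.
Qed.

End Additive.

(** * The shift functor is fully faithful *)

Section Shift.
Variable D : shiftCategory.

Lemma susp_zero_terminal (X : D) (f : Hom X (susp zobj)) : f = 0.
Proof. by rewrite -[f]comp1m -fmor1 [idm zobj]zobj_initial fmor0 comp0m. Qed.

Lemma susp_faithful (X Y : D) (f : Hom X Y) : fmor susp f = 0 -> f = 0.
Proof.
move=> f0; have [k [_ Kk]] := desuspK_iso X.
by rewrite -[f]compm1 -Kk compmA desuspK_natural f0 fmor0 compm0 comp0m.
Qed.

Lemma desusp_faithful (X Y : D) (f : Hom X Y) : fmor desusp f = 0 -> f = 0.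
Proof.
move=> f0; have [k [_ Kk]] := suspK_iso X.
by rewrite -[f]compm1 -Kk compmA suspK_natural f0 fmor0 compm0 comp0m.
Qed.

Lemma susp_inj (X Y : D) (f g : Hom X Y) : fmor susp f = fmor susp g -> f = g.
Proof.
move=> fg; apply/eqP; rewrite -subr_eq0; apply/eqP.
by apply: susp_faithful; rewrite fmorB fg subrr.
Qed.

Lemma susp_full (X Y : D) (g : Hom (susp X) (susp Y)) :
  exists f : Hom X Y, fmor susp f = g.
Proof.
have [kX [kKX KkX]] := desuspK_iso X; have [kY [kKY KkY]] := desuspK_iso Y.
exists (desuspK Y \oc fmor desusp g \oc kX).
apply/eqP; rewrite -subr_eq0; apply/eqP; apply: desusp_faithful.
rewrite fmorB; apply/eqP; rewrite subr_eq0; apply/eqP.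
rewrite -[LHS]comp1m -kKY -compmA -desuspK_natural.
by rewrite -!compmA kKX compm1 compmA kKY comp1m.
Qed.

Lemma isomorphic_susp_desusp (X : D) : isomorphic X (susp (desusp X)).
Proof. by apply: isomorphic_sym; exists (suspK X); apply: suspK_iso. Qed.

Lemma isomorphic_desusp_susp (X : D) : isomorphic X (desusp (susp X)).
Proof. by apply: isomorphic_sym; exists (desuspK X); apply: desuspK_iso. Qed.

Lemma hom_desusp_eq0 (X Y : D) :
  (forall f : Hom (susp X) Y, f = 0) -> forall f : Hom X (desusp Y), f = 0.
Proof.
move=> van f; apply: susp_faithful; have [k [kK Kk]] := suspK_iso Y.
by rewrite -[LHS]comp1m -kK -compmA (van (_ \oc _)) compm0.
Qed.

End Shift.

(** * Exact sequences of a distinguished triangle *)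

Section Exactness.
Variable D : triangulatedCategory.
Variables (X Y Z : D) (u : Hom X Y) (v : Hom Y Z) (w : Hom Z (susp X)).
Hypothesis uvw : dist u v w.

Lemma dist_comp12 : v \oc u = 0.
Proof.
have ev : u \oc idm X = u \oc idm X by [].
have [h [<- _]] := dist_mor (dist_id X) uvw ev.
exact: compm0.
Qed.

(** Exactness of Hom(T, -) at Hom(T, Y): complete [(a, 0)] to a morphism from the
    rotated triangle [T -> 0 -> Sigma T], and desuspend its third component. *)
Lemma dist_lift2 (T : D) (a : Hom T Y) :
  v \oc a = 0 -> exists b : Hom T X, u \oc b = a.
Proof.
move=> va.
have dT := (dist_rot _ _ _).1 (dist_id T).
have dX := (dist_rot _ _ _).1 uvw.
have sq : (0 : Hom zobj Z) \oc (0 : Hom T zobj) = v \oc a by rewrite va comp0m.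
have [h [_ hE]] := dist_mor dT dX sq.
have [b bE] := susp_full h; exists b; apply: susp_inj.
by apply: oppr_inj; rewrite fmorM bE -compNm -hE compmN fmor1 compm1.
Qed.

(** Exactness of Hom(-, T) at Hom(Y, T): complete [(0, a)] to a morphism to the
    triangle [0 -> T = T]. *)
Lemma dist_extend2 (T : D) (a : Hom Y T) :
  a \oc u = 0 -> exists b : Hom Z T, b \oc v = a.
Proof.
move=> au.
have dT : dist (0 : Hom zobj T) (idm T) (0 : Hom T (susp zobj)).
  apply/dist_rot.
  have iso0 : is_iso (0 : Hom (zobj : D) (susp zobj)).
    exists 0; split; first by rewrite [RHS]zobj_initial comp0m.
    by rewrite [RHS]susp_zero_terminal comp0m.
  apply: (dist_iso (is_iso_idm T) (is_iso_idm T) iso0 _ _ _ (dist_id T)) => //.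
    by rewrite !comp0m.
  by rewrite fmor0 oppr0 comp0m compm0.
have sq : a \oc u = (0 : Hom zobj T) \oc (0 : Hom X zobj) by rewrite au comp0m.
have [b [bE _]] := dist_mor uvw dT sq.
by exists b; rewrite bE comp1m.
Qed.

End Exactness.

Section LongExactness.
Variable D : triangulatedCategory.
Variables (X Y Z : D) (u : Hom X Y) (v : Hom Y Z) (w : Hom Z (susp X)).
Hypothesis uvw : dist u v w.

Let vwu := (dist_rot u v w).1 uvw.
Let wuv := (dist_rot v w _).1 vwu.

Lemma dist_comp23 : w \oc v = 0.
Proof. exact: dist_comp12 vwu. Qed.

Lemma dist_comp31 : fmor susp u \oc w = 0.
Proof. by apply: oppr_inj; rewrite -compNm oppr0 (dist_comp12 wuv). Qed.

Lemma dist_lift3 (T : D) (a : Hom T Z) :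
  w \oc a = 0 -> exists b : Hom T Y, v \oc b = a.
Proof. exact: dist_lift2 vwu T a. Qed.

Lemma dist_extend3 (T : D) (a : Hom Z T) :
  a \oc v = 0 -> exists b : Hom (susp X) T, b \oc w = a.
Proof. exact: dist_extend2 vwu T a. Qed.

Lemma dist_lift1 (T : D) (a : Hom T (susp X)) :
  fmor susp u \oc a = 0 -> exists b : Hom T Z, w \oc b = a.
Proof. by move=> ua; apply: (dist_lift2 wuv); rewrite compNm ua oppr0. Qed.

(** Exactness of Hom(-, T) at Hom(X, T), with [a] suspended so that the boundary
    map applies to it. *)
Lemma dist_extend1 (T : D) (a : Hom X T) :
  fmor susp a \oc w = 0 -> exists b : Hom Y T, b \oc u = a.
Proof.
move=> /(dist_extend2 wuv)[b bE]; have [c cE] := susp_full b.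
exists (- c); apply: susp_inj; rewrite fmorM -bE compmN -compNm -cE.
by rewrite fmorN.
Qed.

(** Together with [dist_comp01], this identifies the maps in the image of
    [ho1_map] before composition with [ae]: they are the maps killed by [u]. *)
Lemma dist_kernel (T : D) (a : Hom T X) :
  u \oc a = 0 ->
  exists b : Hom T (desusp Z), a = desuspK X \oc fmor desusp w \oc b.
Proof.
move=> ua; have [k [_ Kk]] := desuspK_iso T.
have [|b bE] := @dist_lift1 (susp T) (fmor susp a); first by rewrite -fmorM ua fmor0.
exists (fmor desusp b \oc k).
rewrite !compmA -[_ \oc fmor desusp b]compmA -fmorM bE -desuspK_natural.
by rewrite -compmA Kk compm1.
Qed.

Lemma dist_comp01 : u \oc (desuspK X \oc fmor desusp w) = 0.
Proof. by rewrite compmA desuspK_natural -compmA -fmorM dist_comp31 fmor0 compm0. Qed.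

Lemma dist_iso_of_zero : idm Z = 0 -> is_iso u.
Proof.
move=> Z0; have zZ (T : D) (f : Hom T Z) : f = 0 by rewrite -[f]comp1m Z0 comp0m.
have [s us] := dist_lift2 uvw (zZ _ (v \oc idm Y)).
exists s; split=> //; apply: susp_inj; apply/eqP; rewrite -subr_eq0 -fmorB.
have [|b <-] := @dist_lift1 (susp X) (fmor susp (s \oc u - idm X)).
  by rewrite -fmorM compmB compmA us comp1m compm1 subrr fmor0.
by rewrite [b]zZ compm0.
Qed.

End LongExactness.

(** Desuspend the cone of [e]; the sign in the rotation axiom is put on [r]. *)
Lemma dist_fiber (D : triangulatedCategory) (X T : D) (e : Hom X T) :
  exists (R : D) (r : Hom R X) (w : Hom T (susp R)), dist r e w.
Proof.
have [C [a [b eab]]] := dist_cone e; have [k [kK Kk]] := suspK_iso C.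
have [r rE] := susp_full (b \oc suspK C).
exists (desusp C), (- r), (k \oc a); apply/dist_rot.
have kiso : is_iso k by exists (suspK C).
apply: (dist_iso (is_iso_idm X) (is_iso_idm T) kiso _ _ _ eab).
- by rewrite comp1m compm1.
- by rewrite compm1.
by rewrite fmorN opprK rE fmor1 comp1m -compmA Kk compm1.
Qed.

(** * Morphisms inverted by Hom functors *)

Section Inverted.
Variable D : triangulatedCategory.

Definition precomp_iso (X Y : D) (f : Hom X Y) (W : D) : Prop :=
  (forall h : Hom Y W, h \oc f = 0 -> h = 0) /\
  (forall g : Hom X W, exists h : Hom Y W, h \oc f = g).

Definition postcomp_iso (A : D) (X Y : D) (f : Hom X Y) : Prop :=
  (forall h : Hom A X, f \oc h = 0 -> h = 0) /\
  (forall g : Hom A Y, exists h : Hom A X, f \oc h = g).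

Definition inverted (V : set D) : morclass D :=
  fun X Y f => forall W, V W -> precomp_iso f W.

Definition coinverted (U : set D) : morclass D :=
  fun X Y f => forall A, U A -> postcomp_iso A f.

Lemma morclassP (A B : morclass D) :
  (forall X Y (f : Hom X Y), A X Y f <-> B X Y f) -> A = B.
Proof.
move=> AB; apply: functional_extensionality_dep => X.
apply: functional_extensionality_dep => Y; apply/seteqP.
by split=> f /AB.
Qed.

Lemma precomp_iso_target (X Y : D) (f : Hom X Y) (W W' : D) :
  isomorphic W W' -> precomp_iso f W -> precomp_iso f W'.
Proof.
move=> [k [k' [k'k kk']]] [inj surj]; split=> [h hf|g].
  by rewrite -[h]comp1m -kk' -compmA [k' \oc h]inj ?compm0 // -compmA hf compm0.
have [h hf] := surj (k' \oc g).
by exists (k \oc h); rewrite -compmA hf compmA kk' comp1m.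
Qed.

Lemma postcomp_iso_source (X Y : D) (f : Hom X Y) (A A' : D) :
  isomorphic A A' -> postcomp_iso A f -> postcomp_iso A' f.
Proof.
move=> [k [k' [k'k kk']]] [inj surj]; split=> [h fh|g].
  by rewrite -[h]compm1 -kk' compmA [h \oc k]inj ?comp0m // compmA fh comp0m.
have [h fh] := surj (g \oc k).
by exists (h \oc k'); rewrite compmA fh -compmA kk' compm1.
Qed.

Lemma precomp_iso_susp (X Y : D) (f : Hom X Y) (W : D) :
  precomp_iso (fmor susp f) W <-> precomp_iso f (desusp W).
Proof.
suff shift W' : precomp_iso (fmor susp f) (susp W') <-> precomp_iso f W'.
  split=> fW; first apply/shift.
    exact: precomp_iso_target (isomorphic_susp_desusp W) fW.
  apply: precomp_iso_target (isomorphic_sym (isomorphic_susp_desusp W)) _.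
  exact/shift.
split=> -[inj surj]; split.
- move=> h hf; apply: susp_faithful; apply: inj.
  by rewrite -fmorM hf fmor0.
- move=> g; have [h hf] := surj (fmor susp g); have [h' h'E] := susp_full h.
  by exists h'; apply: susp_inj; rewrite fmorM h'E.
- move=> h; have [h' <-] := susp_full h; rewrite -fmorM => /susp_faithful h'f.
  by rewrite [h']inj // fmor0.
- move=> g; have [g' <-] := susp_full g; have [h hf] := surj g'.
  by exists (fmor susp h); rewrite -fmorM hf.
Qed.

Lemma inverted_three_for_two (V : set D) : three_for_two (inverted V).
Proof.
move=> X Y Z f g; split=> Ef Eg W VW;
  have [fi fs] := Ef W VW; have [gi gs] := Eg W VW; split.
- by move=> h; rewrite compmA => /fi/gi.
- move=> a; have [b <-] := fs a; have [c <-] := gs b.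
  by exists c; rewrite compmA.
- by move=> h hg; apply: gi; rewrite compmA hg comp0m.
- move=> a; have [c cE] := gs (a \oc f); exists c.
  apply/eqP; rewrite -subr_eq0; apply/eqP; apply: fi.
  by rewrite compBm -compmA cE subrr.
- move=> h hf; have [c cE] := fs h.
  by rewrite -cE [c]gi ?comp0m // compmA cE.
- move=> a; have [c cE] := gs a.
  by exists (c \oc g); rewrite -compmA.
Qed.

Lemma coinverted_three_for_two (U : set D) : three_for_two (coinverted U).
Proof.
move=> X Y Z f g; split=> Ef Eg A UA;
  have [fi fs] := Ef A UA; have [gi gs] := Eg A UA; split.
- by move=> h; rewrite -compmA => /gi/fi.
- move=> a; have [b <-] := gs a; have [c <-] := fs b.
  by exists c; rewrite compmA.
- move=> h gh; have [c cE] := fs h.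
  by rewrite -cE [c]gi ?compm0 // -compmA cE.
- move=> a; have [c cE] := gs a.
  by exists (f \oc c); rewrite compmA.
- by move=> h fh; apply: gi; rewrite -compmA fh compm0.
- move=> a; have [c cE] := gs (g \oc a); exists c.
  apply/eqP; rewrite -subr_eq0; apply/eqP; apply: fi.
  by rewrite compmB compmA cE subrr.
Qed.

Lemma ho2_map_injP (E1 Ce M0 Cm : D) (ae : Hom E1 Ce) (bm : Hom Cm (susp M0)) :
  injective (ho2_map ae bm) <->
  forall phi : Hom Ce Cm, bm \oc phi \oc ae = 0 -> phi = 0.
Proof.
split=> [inj phi phi0|inj phi psi].
  by apply: inj; rewrite /ho2_map phi0 compm0 comp0m.
move=> /eqP; rewrite /ho2_map -subr_eq0 -compBm -compmB => /eqP/inj/eqP.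
by rewrite subr_eq0 => /eqP.
Qed.

(** The cone of [W -> 0] is the suspension of [W].  So (HO1) says that maps
    [E1 -> W] vanishing on [E0] are zero, and (HO2) that a map [Ce -> Sigma W]
    vanishing on [E1] is zero; such maps are the obstructions to extending maps
    [E0 -> W] to [E1]. *)
Lemma horth_to_zero (E0 E1 W Z : D) (e : Hom E0 E1) (z : Hom W Z) :
  idm Z = 0 -> horth e z <-> precomp_iso e W.
Proof.
move=> Z0; have zZ (T : D) (f : Hom T Z) : f = 0 by rewrite -[f]comp1m Z0 comp0m.
have zSZ (T : D) (f : Hom T (susp Z)) : f = 0.
  by rewrite -[f]comp1m -fmor1 Z0 fmor0 comp0m.
split=> [orth|[inj surj]].
  have [Ce [ae [be de]]] := dist_cone e; have [Cm [am [bm dm]]] := dist_cone z.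
  have [ho1 /ho2_map_injP ho2] := orth _ _ _ _ _ _ de dm; split=> [h he|g].
    have [c cE] := dist_extend2 de he.
    have [phi phiE] := dist_kernel dm (zZ _ (z \oc c)).
    by rewrite -cE phiE; apply: ho1.
  have [phi phiE] := dist_lift1 dm (zSZ _ (fmor susp z \oc (fmor susp g \oc be))).
  apply: (dist_extend1 de); rewrite -phiE [phi]ho2 ?compm0 //.
  by rewrite phiE -compmA (dist_comp23 de) compm0.
move=> Ce ae be Cm am bm de dm; split=> [phi|].
  by apply: inj; rewrite /ho1_map -[LHS]compmA (dist_comp12 de) compm0.
apply/ho2_map_injP => phi phi0.
have [c cE] := dist_extend3 de phi0; have [g gE] := susp_full c.
have [h hE] := surj g.
have bphi : bm \oc phi = 0.
  by rewrite -cE -gE -hE fmorM -compmA (dist_comp31 de) compm0.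
by have [psi <-] := dist_lift3 dm bphi; rewrite [psi]zZ compm0.
Qed.

(** The cone of [0 -> A] is [A].  So (HO1) says that maps [A -> M0] killed by [m]
    are zero, and (HO2) that all maps [A -> M1] are zero in the cone of [m], that
    is, lift to [M0].  The source is any zero object, so that the suspension of
    [0 -> A] is covered. *)
Lemma horth_from_zero (Z A M0 M1 : D) (z : Hom Z A) (m : Hom M0 M1) :
  idm Z = 0 -> horth z m <-> postcomp_iso A m.
Proof.
move=> Z0; have zZ (T : D) (f : Hom Z T) : f = 0 by rewrite -[f]compm1 Z0 compm0.
have zSZ (T : D) (f : Hom (susp Z) T) : f = 0.
  by rewrite -[f]compm1 -fmor1 Z0 fmor0 compm0.
split=> [orth|[inj surj]].
  have [Ce [ae [be de]]] := dist_cone z; have [Cm [am [bm dm]]] := dist_cone m.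
  have [ho1 /ho2_map_injP ho2] := orth _ _ _ _ _ _ de dm; split=> [h mh|g].
    have [psi ->] := dist_kernel dm mh.
    have [phi <-] := dist_extend2 de (zZ _ (psi \oc z)).
    by rewrite compmA; apply: ho1.
  have [phi phiE] := dist_extend2 de (zZ _ (am \oc g \oc z)).
  apply: (dist_lift2 dm); rewrite -phiE [phi]ho2 ?comp0m //.
  by rewrite -compmA phiE compmA (dist_comp23 dm) comp0m.
move=> Ce ae be Cm am bm de dm; split=> [phi|].
  apply: inj; rewrite /ho1_map -compmA [m \oc _]compmA (dist_comp01 dm).
  exact: comp0m.
apply/ho2_map_injP => phi; rewrite -compmA => phi0.
have [g gE] := dist_lift3 dm phi0; have [h hE] := surj g.
have phia : phi \oc ae = 0 by rewrite -gE -hE compmA (dist_comp12 dm) comp0m.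
by have [c <-] := dist_extend3 de phia; rewrite [c]zSZ comp0m.
Qed.

End Inverted.

(** * Torsion pairs *)

Section TPair.
Variable D : triangulatedCategory.

(** A t-structure in terms of its aisle and coaisle (D^{<=0}, D^{>=1}), which
    spares the shift on the second class. *)
Record t_pair (U V : set D) : Prop := {
  tp_isoU : iso_closed U;
  tp_isoV : iso_closed V;
  tp_hom0 : forall X Y : D, U X -> V Y -> forall f : Hom X Y, f = 0;
  tp_susp : forall X, U X -> U (susp X);
  tp_desusp : forall X, V X -> V (desusp X);
  tp_trunc : forall X : D,
    exists (A B : D) (u : Hom A X) (v : Hom X B) (w : Hom B (susp A)),
      [/\ U A, V B & dist u v w]
}.

Variables U V : set D.
Hypothesis UV : t_pair U V.

Lemma trunc_postcomp_iso (A X B : D)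
    (u : Hom A X) (v : Hom X B) (w : Hom B (susp A)) :
  dist u v w -> V B -> coinverted U u.
Proof.
move=> d VB A0 UA0; split=> [h uh|g].
  apply: susp_faithful; have [|b <-] := @dist_lift1 _ _ _ _ _ _ _ d _ (fmor susp h).
    by rewrite -fmorM uh fmor0.
  by rewrite (tp_hom0 UV (tp_susp UV UA0) VB b) compm0.
exact: dist_lift2 d _ _ (tp_hom0 UV UA0 VB _).
Qed.

Lemma trunc_precomp_iso (A X B : D)
    (u : Hom A X) (v : Hom X B) (w : Hom B (susp A)) :
  dist u v w -> U A -> inverted V v.
Proof.
move=> d UA W VW; split=> [h hv|g].
  have [b <-] := dist_extend3 d hv.
  by rewrite (tp_hom0 UV (tp_susp UV UA) VW b) comp0m.
exact: dist_extend2 d _ _ (tp_hom0 UV UA VW _).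
Qed.

(** The truncation [X -> B] of such an [X] is zero, although it induces an
    injection Hom(B, B) -> Hom(X, B); so [B] is zero and [A -> X] is invertible. *)
Lemma aisle_of_hom0 (X : D) :
  (forall W, V W -> forall f : Hom X W, f = 0) -> U X.
Proof.
move=> X0; have [A [B [u [v [w [UA VB d]]]]]] := tp_trunc UV X.
have v0 := X0 _ VB v.
apply: (tp_isoU UV _ UA); exists u; apply: (dist_iso_of_zero d).
by apply: (trunc_precomp_iso d UA VB).1; rewrite v0 compm0.
Qed.

Lemma coaisle_of_hom0 (X : D) :
  (forall A, U A -> forall f : Hom A X, f = 0) -> V X.
Proof.
move=> X0; have [A [B [u [v [w [UA VB d]]]]]] := tp_trunc UV X.
have u0 := X0 _ UA u.
apply: (tp_isoV UV _ VB); apply: isomorphic_sym; exists v.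
apply: (dist_iso_of_zero ((dist_rot _ _ _).1 d)); rewrite -fmor1.
have -> : idm A = 0; last exact: fmor0.
by apply: (trunc_postcomp_iso d VB UA).1; rewrite u0 comp0m.
Qed.

(** Such an [e] is isomorphic under [X] to the truncation [X -> B], whose fibre
    [A] lies in the aisle; the next term of the long exact sequence is
    Hom(Sigma A, Sigma W) = 0. *)
Lemma reflection_susp_mono (X T W : D) (e : Hom X T) (c : Hom T (susp W)) :
  inverted V e -> V T -> V W -> c \oc e = 0 -> c = 0.
Proof.
move=> Ee VT VW ce; have [A [B [u [v [w [UA VB d]]]]]] := tp_trunc UV X.
have [g ge] := (Ee _ VB).2 v.
have [g' g'v] := (trunc_precomp_iso d UA VT).2 e.
have g'g : g' \oc g = idm T.
  apply/eqP; rewrite -subr_eq0; apply/eqP; apply: (Ee _ VT).1.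
  by rewrite compBm -compmA ge g'v comp1m subrr.
have cg'v : c \oc g' \oc v = 0 by rewrite -compmA g'v.
have [b bE] := dist_extend3 d cg'v; have [b' b'E] := susp_full b.
rewrite -[c]compm1 -g'g compmA -bE -b'E.
by rewrite (tp_hom0 UV UA VW b') fmor0 !comp0m.
Qed.

(** A map [R -> W] to the coaisle, once suspended, restricts along [w] to a map
    from [T] to a suspension of the coaisle that vanishes on [X].  So it is zero,
    and [R -> W] extends to [X], then to [T], where [R] maps to zero. *)
Lemma reflection_fiber_aisle (R X T : D)
    (r : Hom R X) (e : Hom X T) (w : Hom T (susp R)) :
  dist r e w -> inverted V e -> V T -> U R.
Proof.
move=> d Ee VT; apply: aisle_of_hom0 => W VW f.
have fw : fmor susp f \oc w = 0.
  apply: (reflection_susp_mono Ee VT VW).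
  by rewrite -compmA (dist_comp23 d) compm0.
have [g <-] := dist_extend1 d fw; have [h <-] := (Ee _ VW).2 g.
by rewrite -compmA (dist_comp12 d) compm0.
Qed.

(** In terms of fibres: a map of M has its fibre in the coaisle, since Hom(A, -)
    inverts it for [A] in the aisle and for the suspension of [A]. *)
Lemma coinverted_cone (M0 M1 Cm : D)
    (m : Hom M0 M1) (am : Hom M1 Cm) (bm : Hom Cm (susp M0)) :
  dist m am bm -> coinverted U m -> V (desusp Cm).
Proof.
move=> d Mm; apply: coaisle_of_hom0 => A UA; apply: hom_desusp_eq0 => y.
have [h hE] := susp_full (bm \oc y).
have bmy : bm \oc y = 0.
  have [inj _] := Mm _ UA; rewrite -hE [h]inj ?fmor0 //.
  by apply: susp_faithful; rewrite fmorM hE compmA (dist_comp31 d) comp0m.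
have [z <-] := dist_lift3 d bmy.
have [z' <-] := (Mm _ (tp_susp UV UA)).2 z.
by rewrite compmA (dist_comp12 d) comp0m.
Qed.

(** The cone of [m] is a suspension of an object of the coaisle, so (HO1) is the
    injectivity of Hom(e, -) on the coaisle.  For (HO2), [phi \oc ae] vanishes
    on the aisle part of [E1], hence factors through the truncation [v] of [E1];
    as [v \oc e] is the truncation of [E0], that factor is zero by
    [reflection_susp_mono]. *)
Lemma inverted_horth_coinverted (E0 E1 M0 M1 : D)
    (e : Hom E0 E1) (m : Hom M0 M1) :
  inverted V e -> coinverted U m -> horth e m.
Proof.
move=> Ee Mm Ce ae be Cm am bm de dm; have VC := coinverted_cone dm Mm.
split=> [phi|].
  rewrite /ho1_map -compmA ((Ee _ VC).1 (phi \oc ae)) ?compm0 //.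
  by rewrite -compmA (dist_comp12 de) compm0.
apply/ho2_map_injP => phi phi0.
have [k [k' [k'k kk']]] := isomorphic_susp_desusp Cm.
have k_mono (T : D) (f : Hom T Cm) : k \oc f = 0 -> f = 0.
  by move=> kf; rewrite -[f]comp1m -k'k -compmA kf compm0.
have [A [B [u [v [w [UA VB d]]]]]] := tp_trunc UV E1.
have phiae : phi \oc ae = 0.
  have phiu : phi \oc ae \oc u = 0.
    have [|g <-] := @dist_lift3 _ _ _ _ _ _ _ dm _ (phi \oc ae \oc u).
      by rewrite !compmA phi0 comp0m.
    have [h <-] := (Mm _ UA).2 g.
    by rewrite compmA (dist_comp12 dm) comp0m.
  have [psi psiE] := dist_extend2 d phiu.
  have Eve : inverted V (v \oc e).
    have [comp _ _] := inverted_three_for_two V e v.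
    by apply: comp => //; apply: trunc_precomp_iso d UA.
  rewrite -psiE [psi]k_mono ?comp0m //.
  apply: (reflection_susp_mono Eve VB VC).
  by rewrite -compmA [psi \oc _]compmA psiE -compmA (dist_comp12 de) !compm0.
have [c <-] := dist_extend3 de phiae; apply: k_mono.
have [g gE] := susp_full (k \oc c); have [h hE] := (Ee _ VC).2 g.
by rewrite compmA -gE -hE fmorM -compmA (dist_comp31 de) compm0.
Qed.

Lemma coslice0_inverted : coslice0 (inverted V) = U.
Proof.
apply/seteqP; split=> X; last first.
  move=> UX W VW; split=> [h _|g]; first exact: (tp_hom0 UV UX VW).
  by exists 0; rewrite comp0m [RHS]zobj_initial.
move=> EX; apply: aisle_of_hom0 => W VW f.
by apply: (EX _ VW).1; rewrite compm0.
Qed.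

Lemma slice0_coinverted : slice0 (coinverted U) = V.
Proof.
apply/seteqP; split=> X; last first.
  move=> VX A UA; split=> [h _|g]; first exact: (tp_hom0 UV UA VX).
  by exists 0; rewrite compm0 [RHS]zobj_terminal.
move=> MX; apply: coaisle_of_hom0 => A UA f.
by apply: (MX _ UA).1; rewrite comp0m.
Qed.

Lemma rorth_inverted : rorth (inverted V) = coinverted U.
Proof.
apply: morclassP => X Y f; split=> [orth A UA|Mf X' Y' x Ex]; last first.
  exact: inverted_horth_coinverted.
apply/(horth_from_zero (0 : Hom zobj A) f (zobj_initial _)); apply: orth.
by have : U A by []; rewrite -{1}coslice0_inverted.
Qed.

Lemma lorth_coinverted : lorth (coinverted U) = inverted V.
Proof.
apply: morclassP => X Y f; split=> [orth W VW|Ef X' Y' x Mx]; last first.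
  exact: inverted_horth_coinverted.
apply/(horth_to_zero f (0 : Hom W zobj) (zobj_initial _)); apply: orth.
by have : V W by []; rewrite -{1}slice0_coinverted.
Qed.

(** Let [B -> X] and [A -> Y] be the aisle parts and [T] the homotopy pushout of
    [X <- B -> A].  Maps from [T] to the coaisle only see [X], because Hom(A, -),
    Hom(B, -) and Hom(Sigma B, -) vanish there; maps from the aisle to [T] only see
    [A], because maps from the aisle to [X] lift to [B]; and [A] and [Y] receive
    the same maps from the aisle. *)
Lemma t_pair_factor (X Y : D) (phi : Hom X Y) :
  exists (T : D) (e : Hom X T) (m : Hom T Y),
    [/\ inverted V e, coinverted U m & phi = m \oc e].
Proof.
have [B [W [b [p [q [UB VW dX]]]]]] := tp_trunc UV X.
have [A [W' [a [p' [q' [UA VW' dY]]]]]] := tp_trunc UV Y.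
have Mb := trunc_postcomp_iso dX VW; have Ma := trunc_postcomp_iso dY VW'.
have [beta betaE] := (Ma _ UB).2 (phi \oc b).
have [Z [i1 [i2 [p1 [p2 [p1i1 p2i2 p2i1 p1i2 idZ]]]]]] := biproduct X A.
(* The cone of [s] is the homotopy pushout, and [theta] kills [s] by [betaE]. *)
pose s := i1 \oc b - i2 \oc beta; pose theta := phi \oc p1 + a \oc p2.
have p1s : p1 \oc s = b.
  by rewrite compmB !compmA p1i1 p1i2 comp1m comp0m subr0.
have theta1 : theta \oc i1 = phi.
  by rewrite compmDl -!compmA p1i1 p2i1 compm0 compm1 addr0.
have theta2 : theta \oc i2 = a.
  by rewrite compmDl -!compmA p1i2 p2i2 compm0 compm1 add0r.
have thetas : theta \oc s = 0.
  by rewrite compmB !compmA theta1 theta2 betaE subrr.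
have [T [c [d dT]]] := dist_cone s.
have [m mc] := dist_extend2 dT thetas.
exists T, (c \oc i1), m; split; last by rewrite compmA mc theta1.
  move=> W0 VW0; split=> [h|g].
    rewrite compmA => hci1.
    have hc : h \oc c = 0.
      rewrite -[LHS]compm1 -idZ compmDr !compmA hci1 comp0m add0r.
      by rewrite (tp_hom0 UV UA VW0 (_ \oc i2)) comp0m.
    have [k <-] := dist_extend3 dT hc.
    by rewrite (tp_hom0 UV (tp_susp UV UB) VW0 k) comp0m.
  have gs : g \oc p1 \oc s = 0 by apply: (tp_hom0 UV UB VW0).
  have [h hE] := dist_extend2 dT gs; exists h.
  by rewrite compmA hE -compmA p1i1 compm1.
move=> A0 UA0; have [inja surja] := Ma _ UA0.
have via_A (h : Hom A0 T) : exists x : Hom A0 A, h = c \oc i2 \oc x.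
  have dh : d \oc h = 0.
    have [|x <-] := @dist_lift1 _ _ _ _ _ _ _ dX _ (d \oc h).
      by rewrite -p1s fmorM compmA -[_ \oc d]compmA (dist_comp31 dT) compm0 comp0m.
    by rewrite (tp_hom0 UV UA0 VW x) compm0.
  have [z zE] := dist_lift3 dT dh; have [y yE] := (Mb _ UA0).2 (p1 \oc z).
  exists (p2 \oc (z - s \oc y)).
  have ip2 : i2 \oc (p2 \oc (z - s \oc y)) = z - s \oc y.
    rewrite -[RHS]comp1m -idZ compmDl -!compmA [p1 \oc _]compmB.
    by rewrite [p1 \oc (s \oc y)]compmA p1s yE subrr compm0 add0r.
  by rewrite -compmA ip2 compmB compmA (dist_comp12 dT) comp0m subr0.
have mci2 : m \oc (c \oc i2) = a by rewrite compmA mc theta2.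
split=> [h|g].
  have [x ->] := via_A h; rewrite compmA mci2 => /inja ->; exact: compm0.
have [x <-] := surja g; exists (c \oc i2 \oc x).
by rewrite compmA mci2.
Qed.

Lemma t_pair_normal_torsion_theory :
  normal_torsion_theory (inverted V, coinverted U).
Proof.
split=> /=.
  split; last 2 first.
  - exact: inverted_three_for_two.
  - exact: coinverted_three_for_two.
  split; last exact: t_pair_factor.
  split; [exact: rorth_inverted | exact: lorth_coinverted |].
  by move=> X Y f Ef W VW; apply/precomp_iso_susp/Ef/(tp_desusp UV).
move=> X T e m Ee Mm R r w d W VW.
have VT : V T by rewrite -slice0_coinverted /slice0 /= -[0](zobj_terminal m).
have UR := reflection_fiber_aisle d Ee VT.
split=> [h _|g]; first exact: zobj_initial.
by exists 0; rewrite comp0m [RHS](tp_hom0 UV UR VW).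
Qed.

End TPair.

Section Bijection.
Variable D : triangulatedCategory.

(** * t-structures and torsion pairs *)

Lemma susp_class_iso_closed (n : int) (S : set D) : iso_closed (susp_class n S).
Proof.
move=> X Y XY [Z SZ XZ]; exists Z => //.
exact: isomorphic_trans (isomorphic_sym XY) XZ.
Qed.

Lemma ge_part_susp_class (S : set D) :
  iso_closed S -> ge_part (susp_class 1 S) 1 = S.
Proof.
move=> isoS; apply/seteqP; split=> X /=.
  move=> [Y [Z SZ YZ] XY]; apply: isoS SZ; apply: isomorphic_sym.
  apply: isomorphic_trans XY (isomorphic_trans (isomorphic_fob desusp YZ) _).
  exact: isomorphic_sym (isomorphic_desusp_susp Z).
move=> SX; exists (susp X); last exact: isomorphic_desusp_susp.
by exists X => //; apply: isomorphic_refl.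
Qed.

Lemma susp_class_ge_part (S : set D) :
  iso_closed S -> susp_class 1 (ge_part S 1) = S.
Proof.
move=> isoS; apply/seteqP; split=> X /=.
  move=> [Y [Z SZ YZ] XY]; apply: isoS SZ; apply: isomorphic_sym.
  apply: isomorphic_trans XY (isomorphic_trans (isomorphic_fob susp YZ) _).
  exact: isomorphic_sym (isomorphic_susp_desusp Z).
move=> SX; exists (desusp X); last exact: isomorphic_susp_desusp.
by exists X => //; apply: isomorphic_refl.
Qed.

Lemma t_structure_t_pair (Dle Dge : set D) :
  is_t_structure Dle Dge -> t_pair Dle (ge_part Dge 1).
Proof.
case=> isole isoge orth lesub gesub trunc; split=> //.
- exact: susp_class_iso_closed.
- by move=> X LX; apply: lesub; exists X => //; apply: isomorphic_refl.
- by move=> X GX; exists X; [apply: gesub | apply: isomorphic_refl].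
Qed.

Lemma t_pair_t_structure (U V : set D) :
  t_pair U V -> is_t_structure U (susp_class 1 V).
Proof.
case=> isoU isoV hom0 suspU desuspV trunc.
split; rewrite ?ge_part_susp_class //.
- exact: susp_class_iso_closed.
- by move=> X [Y UY XY]; apply: isoU (isomorphic_sym XY) (suspU _ UY).
- move=> X VX; exists (desusp X); [exact: desuspV | exact: isomorphic_susp_desusp].
Qed.

(** * The torsion pair of a normal torsion theory *)

Section TorsionTheory.
Variables E M : morclass D.
Hypothesis pfs : pre_factorization_system E M.

Lemma slice0P (W : D) :
  slice0 M W <-> forall X Y (e : Hom X Y), E e -> precomp_iso e W.
Proof.
have Z0 : idm (zobj : D) = 0 by apply: zobj_initial.
rewrite /slice0 /= -(pfs_rorth pfs); split=> orth X Y e Ee.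
  by apply/(horth_to_zero e (0 : Hom W zobj) Z0); apply: orth.
by apply/(horth_to_zero e (0 : Hom W zobj) Z0); apply: orth.
Qed.

Lemma coslice0P (A : D) :
  coslice0 E A <-> forall X Y (m : Hom X Y), M m -> postcomp_iso A m.
Proof.
have Z0 : idm (zobj : D) = 0 by apply: zobj_initial.
rewrite /coslice0 /= -(pfs_lorth pfs); split=> orth X Y m Mm.
  by apply/(horth_from_zero (0 : Hom zobj A) m Z0); apply: orth.
by apply/(horth_from_zero (0 : Hom zobj A) m Z0); apply: orth.
Qed.

End TorsionTheory.

(** The truncation of [X] comes from a factorization [X -> T -> 0]: its fibre [R]
    has [R -> 0] in E by normality, and [0 -> R] is in E by 3-for-2, as
    [0 -> R -> 0] is the identity. *)
Lemma normal_torsion_theory_t_pair (E M : morclass D) :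
  normal_torsion_theory (E, M) -> t_pair (coslice0 E) (slice0 M).
Proof.
move=> [[[]] /= pfs factor E32 _ nrm].
have UP := coslice0P pfs; have VP := slice0P pfs.
split.
- move=> A A' AA' /UP UA; apply/UP => X Y m Mm.
  exact: postcomp_iso_source AA' (UA _ _ _ Mm).
- move=> W W' WW' /VP VW; apply/VP => X Y e Ee.
  exact: precomp_iso_target WW' (VW _ _ _ Ee).
- move=> A W UA /VP VW f; apply: (VW _ _ _ UA).1; exact: compm0.
- move=> A UA; apply/UP => X Y m Mm.
  have Z0 : idm (susp (zobj : D)) = 0 by apply: susp_zero_terminal.
  apply/(horth_from_zero (fmor susp (0 : Hom zobj A)) m Z0).
  by move: (pfs_susp pfs UA); rewrite -(pfs_lorth pfs); apply.
- move=> W /VP VW; apply/VP => X Y e Ee.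
  by apply/precomp_iso_susp/VW/(pfs_susp pfs).
move=> X; have [T [e [m [Ee Mm _]]]] := factor X zobj 0.
have [R [r [w d]]] := dist_fiber e.
exists R, T, r, e, w; split=> //; last by rewrite /slice0 /= -[0](zobj_terminal m).
have ER := nrm _ _ _ _ Ee Mm _ _ _ d.
have [_ _] := E32 _ _ _ (0 : Hom zobj R) (0 : Hom R zobj); apply=> //.
rewrite comp0m; apply/UP => X' Y' f _.
split=> [h _|g]; first exact: zobj_initial.
by exists 0; rewrite compm0 [RHS]zobj_initial.
Qed.

(** Each class is included in its candidate by the characterizations of the
    slices, and orthogonality turns the inclusion for [M] into the missing one
    for [E]. *)
Lemma normal_torsion_theory_inverted (E M : morclass D) :
  normal_torsion_theory (E, M) ->
  E = inverted (slice0 M) /\ M = coinverted (coslice0 E).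
Proof.
move=> EM; have tp := normal_torsion_theory_t_pair EM.
have [[[/= pfs _] _ _] _] := EM.
have EE : E = inverted (slice0 M).
  apply: morclassP => X Y f; split=> [Ef W /(slice0P pfs)|]; first exact.
  rewrite -(pfs_lorth pfs) -(lorth_coinverted tp) => orth X' Y' m Mm.
  by apply: orth => A /(coslice0P pfs); apply.
split=> //; rewrite -[LHS](pfs_rorth pfs) -(rorth_inverted tp).
by rewrite -EE.
Qed.

End Bijection.

Theorem theoremI (D : triangulatedCategory) :
  set_bij (@normal_torsion_theory D) (@t_structure D) (@t_of_tt D).
Proof.
split.
- move=> [E M] EM; apply: t_pair_t_structure.
  exact: normal_torsion_theory_t_pair EM.
- move=> [E M] [E' M']; rewrite !inE => EM EM' [eqU eqSV].
  have tp := normal_torsion_theory_t_pair EM.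
  have tp' := normal_torsion_theory_t_pair EM'.
  have eqV : slice0 M = slice0 M'.
    rewrite -(ge_part_susp_class (tp_isoV tp)) eqSV.
    exact: ge_part_susp_class (tp_isoV tp').
  have [EE MM] := normal_torsion_theory_inverted EM.
  have [EE' MM'] := normal_torsion_theory_inverted EM'.
  by congr pair; [rewrite EE EE' eqV | rewrite MM MM'; congr coinverted].
move=> [Dle Dge] ts; have tp := t_structure_t_pair ts.
exists (inverted (ge_part Dge 1), coinverted Dle).
  exact: t_pair_normal_torsion_theory tp.
rewrite /t_of_tt /= (coslice0_inverted tp) (slice0_coinverted tp).
by rewrite susp_class_ge_part //; apply: tge_iso ts.
Qed.
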